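(* Let $p=p(n)\in[0,1]$ satisfy $p\gg n^{-1}$, i.e. $n\,p(n)\to\infty$ as $n\to\infty$, and let $G\in\mathcal{G}(n,p)$. Then asymptotically almost surely the tree-width of $G$ satisfies $$\operatorname{tw}(G)=n-O\left(\sqrt{\frac{n}{p}}\right),$$ that is, there is a constant $C>0$ such that $\Pr\left(n-C\sqrt{n/p}\le \operatorname{tw}(G)\le n\right)\to 1$ as $n\to\infty$.
   Context: All graphs are finite and simple. $\mathcal{G}(n,p)$ is the Erdős–Rényi random graph on $n$ labeled vertices in which each pair of vertices is an edge independently with probability $p$. A property holds asymptotically almost surely (a.a.s.) if its probability tends to $1$ as $n\to\infty$. $\operatorname{tw}(G)$ denotes the usual tree-width of $G$ (the minimum over all tree decompositions of the maximum bag size minus one). *)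

(* Defs.v *)
From HB Require Import structures.
From mathcomp Require Import all_boot all_order all_algebra.
From mathcomp Require Import all_classical all_reals all_analysis.

Set Implicit Arguments.
Unset Strict Implicit.
Unset Printing Implicit Defensive.

Import Order.TTheory GRing.Theory Num.Theory.
Import numFieldNormedType.Exports.

Local Open Scope ring_scope.

Notation vpair V := {e : {set V} | #|e| == 2%N}.

(* Any set of unordered pairs of distinct vertices is a simple graph. *)
Notation sgraph V := {set vpair V}.

Definition adj (V : finType) (G : sgraph V) : rel V :=
  fun x y => [exists e in G, val e == [set x; y]%SET].

Definition is_tree (T : finType) (F : sgraph T) : Prop :=
  [/\ (0 < #|T|)%N,
      (forall s t : T, connect (adj F) s t) &
      (* [ucycle] also accepts the empty sequence and x, y, x along an edge;
         genuine cycles have at least three vertices. *)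
      (forall c : seq T, ucycle (adj F) c -> (size c < 3)%N)].

Definition is_tree_decomposition (V : finType) (G : sgraph V)
    (T : finType) (F : sgraph T) (B : T -> {set V}) : Prop :=
  [/\ is_tree F,
      (forall v : V, exists t : T, v \in B t),
      (forall e : vpair V, e \in G -> exists t : T, val e \subset B t) &
      (forall (v : V) (s t : T), v \in B s -> v \in B t ->
         connect (fun a b => [&& adj F a b, v \in B a & v \in B b]) s t)].

Definition max_bag (V T : finType) (B : T -> {set V}) : nat :=
  (\max_(t : T) #|B t|)%N.

Definition has_max_bag (V : finType) (G : sgraph V) (k : nat) : Prop :=
  exists (T : finType) (F : sgraph T) (B : T -> {set V}),
    is_tree_decomposition G F B /\ max_bag B = k.

Lemma has_max_bag_ex (V : finType) (G : sgraph V) :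
  exists k, `[< has_max_bag G k >].
Proof.
exists #|V|; apply/asboolP.
exists unit, finset.set0, (fun _ => [set: V]%SET); split; last first.
  by rewrite /max_bag (big_pred1 tt) ?cardsT// => -[].
split.
- split; first by rewrite card_unit.
  + by case; case; exact: connect0.
  + move=> c /andP[_ /card_uniqP <-].
    by rewrite (leq_ltn_trans (max_card _))// card_unit.
- by move=> v; exists tt; rewrite inE.
- by move=> e _; exists tt; exact: finset.subsetT.
- by move=> v [] [] _ _; exact: connect0.
Qed.

(* Integer-valued: the graph without vertices has tree-width -1. *)
Definition treewidth (V : finType) (G : sgraph V) : int :=
  (ex_minn (has_max_bag_ex G))%:Z - 1.

(* The law of G(n, p): each pair is an edge independently with probability p. *)
Definition Gnp_weight (R : realType) (n : nat) (p : R) (G : sgraph 'I_n) : R :=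
  \prod_(e : vpair 'I_n) (if e \in G then p else 1 - p).

Definition Gnp_prob (R : realType) (n : nat) (p : R)
    (A : pred (sgraph 'I_n)) : R :=
  \sum_(G : sgraph 'I_n | A G) Gnp_weight p G.

(* Main.v *)
Require Import Defs.
From HB Require Import structures.
From mathcomp Require Import all_boot all_order all_algebra.
From mathcomp Require Import all_classical all_reals all_analysis.
From mathcomp Require Import zify lra.

Set Implicit Arguments.
Unset Strict Implicit.
Unset Printing Implicit Defensive.

Import Order.TTheory GRing.Theory Num.Theory.
Import numFieldNormedType.Exports.

Local Open Scope ring_scope.

(* Put [s] about [2 sqrt(n/p)].  A union bound over the at most [4^n] pairs of
   disjoint vertex sets of size at least [s], each pair being joined by no edge
   with probability at most [(1 - p)^(s^2) <= exp (-4 n)], shows that a.a.s. any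
   two such sets are joined by an edge.  In such a graph a tree decomposition
   cannot have all bags of size at most [n - 3 s]: otherwise, for every node [t],
   one branch of the tree at [t] carries at least [s] vertices outside the bag of
   [t]; let [t] point to its neighbour in that branch.  As the tree is acyclic,
   some two adjacent nodes point to each other, and the vertices carried by their
   two branches are disjoint sets of size at least [s] with no edge between. *)

(** * Paths and cycles in trees *)

Lemma adj_sym (V : finType) (G : sgraph V) : symmetric (adj G).
Proof. by move=> x y; rewrite /adj; under eq_existsb do rewrite finset.setUC. Qed.

Lemma adj_irr (V : finType) (G : sgraph V) : irreflexive (adj G).
Proof.
move=> x; apply/existsP => -[e /andP[_ /eqP ex]].
by have := valP e; rewrite ex finset.setUid cards1.
Qed.

Definition adj_avoid (T : finType) (F : sgraph T) (t : T) : rel T :=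
  fun a b => [&& adj F a b, a != t & b != t].

Lemma adj_avoid_csym (T : finType) (F : sgraph T) (t : T) :
  connect_sym (adj_avoid F t).
Proof.
by apply: sym_connect_sym => a b; rewrite /adj_avoid adj_sym [(_ != t) && _]andbC.
Qed.

(** Neither path uses the edge [ab], since each misses one of its ends. Joined at [u] they lead from
    [b] to [a], and the edge closes a cycle. *)
Lemma acyclic_edge_separates (T : finType) (F : sgraph T) (a b u : T) :
  (forall c : seq T, ucycle (adj F) c -> (size c < 3)%N) -> adj F a b ->
  connect (adj_avoid F a) b u -> connect (adj_avoid F b) a u -> False.
Proof.
move=> acyc Fab cbu cau.
pose e x y := adj F x y && ([set x; y] != [set a; b])%SET.
have e_csym : connect_sym e.
  by apply: sym_connect_sym => x y; rewrite /e adj_sym finset.setUC.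
have sub t : t \in [set a; b]%SET -> subrel (connect (adj_avoid F t)) (connect e).
  move=> tab; apply: connect_sub => x y /and3P[Fxy xt yt]; apply: connect1.
  rewrite /e Fxy; apply: contraTneq tab => <-.
  by rewrite !inE negb_or eq_sym xt eq_sym yt.
have : connect e b a.
  apply: (@connect_trans _ _ u); first by apply: sub cbu; rewrite !inE eqxx.
  by rewrite e_csym; apply: sub cau; rewrite !inE eqxx orbT.
move=> /connectP[q eq_q]; move: (eq_q) => /shortenP[p ep up _] {q eq_q} ap.
(* The path is not empty because [a] and [b] differ, and it is not a single step because that step
   would be the deleted edge. So the cycle has at least three vertices. *)
have szp : (1 < size p)%N.
  case: p ep ap {up} => [|x [|y p]] //=; first by move=> _ ab; rewrite ab adj_irr in Fab.
  by rewrite andbT => + ax; rewrite /e -ax finset.setUC eqxx andbF.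
have /acyc : ucycle (adj F) (b :: p).
  rewrite /ucycle up andbT /= rcons_path -ap Fab andbT.
  by apply: sub_path ep => x y /andP[].
by rewrite /= ltnNge ltnS szp.
Qed.

Lemma connect_first_step (T : finType) (F : sgraph T) (t u : T) :
  u != t -> connect (adj F) t u ->
  exists2 a, adj F t a & connect (adj_avoid F t) a u.
Proof.
move=> + /connectP[q Fq]; case/shortenP: Fq => [[|a p]] /=.
  by move=> _ _ _ + uE; rewrite uE eqxx.
move=> /andP[Fta Fp] /andP[tp _] _ _ ->; exists a => //.
apply/connectP; exists p => //.
apply: (sub_in_path (P := predC1 t)) Fp.
  by move=> x y; rewrite !inE => xt yt Fxy; rewrite /adj_avoid Fxy xt yt.
by apply/allP => x xp; apply: contraNneq tp => <-.
Qed.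

(** Iterating [f] from [t0] ends in a cycle of [f], which is also a cycle of [F]. Acyclicity leaves
    length one or two, and [adj] has no loops. *)
Lemma acyclic_pointer_2cycle (T : finType) (F : sgraph T) (f : T -> T) (t0 : T) :
  (forall c : seq T, ucycle (adj F) c -> (size c < 3)%N) ->
  (forall t, adj F t (f t)) -> exists t, f (f t) = t.
Proof.
move=> acyc Ff.
have /trajectP[i lt_i eq_i] := looping_order f t0.
pose t := iter i f t0; exists t.
have cyc : fcycle f (orbit f t).
  apply/(orbitPcycle 0 3); exists (order f t0 - i).-1.
  by rewrite prednK ?subn_gt0// -iterD subnK// ltnW.
have /acyc : ucycle (adj F) (orbit f t).
  rewrite /ucycle orbit_uniq andbT.
  by apply: sub_cycle cyc => x y /eqP <-; exact: Ff.
move: cyc => /(orbitPcycle 0 4); rewrite size_orbit.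
case: (order f t) (order_gt0 f t) => [|[|[|]]] //= _ ft.
by have := Ff t; rewrite ft adj_irr.
Qed.

(** Let [D] be minimal among the label sets carrying at least [s] elements. The rest carries fewer
    than [s], so [D] carries more than [2 s]. Dropping one label leaves fewer than [s], so that
    label alone is large. *)
Lemma exists_large_class (V T : finType) (U : {set V}) (g : V -> T) (s : nat) :
  (0 < s)%N -> (3 * s <= #|U|)%N ->
  (forall D : {set T}, (#|[set v in U | g v \in D]%SET| < s)%N \/
                       (#|[set v in U | g v \notin D]%SET| < s)%N) ->
  exists c, (s <= #|[set v in U | g v == c]%SET|)%N.
Proof.
move=> s0 Us split_g.
pose W (D : {set T}) := [set v in U | g v \in D]%SET.
have WU D : (#|W D| + #|[set v in U | g v \notin D]%SET| = #|U|)%N.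
  rewrite -(cardsID [set v | g v \in D]%SET U).
  by congr (_ + _)%N; apply: eq_card => v; rewrite !inE 1?andbC.
have [D /minsetP[sD minD]] : {D | minset (fun D => (s <= #|W D|)%N) D}.
  apply: ex_minset; exists finset.setT.
  have -> : W finset.setT = U by apply/finset.setP => v; rewrite !inE andbT.
  by lia.
have big : (2 * s < #|W D|)%N.
  by have := WU D; have := split_g D; rewrite -/(W D); move: sD => /= sD [] ? ?; lia.
have [D0|[c cD]] := set_0Vmem D.
  suff : #|W D| = 0%N by lia.
  by rewrite D0; apply: eq_card0 => v; rewrite !inE andbF.
exists c.
have small : (#|W (D :\ c)%SET| < s)%N.
  rewrite ltnNge; apply/negP => /minD/(_ (subD1set _ _)) DE.
  by move: cD; rewrite -DE !inE eqxx.
have : (#|W D| <= #|W (D :\ c)%SET| + #|[set v in U | g v == c]%SET|)%N.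
  apply: leq_trans (leq_card_setU _ _); apply/subset_leq_card/fintype.subsetP => v.
  by rewrite !inE => /andP[-> ->]; rewrite !andbT; case: eqP.
lia.
Qed.

(** * Tree decompositions of graphs whose large sets are linked *)

Definition no_edge_between (V : finType) (G : sgraph V) (A B : {set V}) : bool :=
  [forall x in A, forall y in B, ~~ adj G x y].

Definition large_sets_linked (V : finType) (G : sgraph V) (s : nat) : bool :=
  [forall A : {set V}, forall B : {set V},
    [&& [disjoint A & B], s <= #|A| & s <= #|B|]%N ==> ~~ no_edge_between G A B].

Lemma large_sets_linkedP (V : finType) (G : sgraph V) (s : nat) (A B : {set V}) :
  large_sets_linked G s -> [disjoint A & B] ->
  {in A & B, forall x y, ~~ adj G x y} -> (#|A| < s)%N \/ (#|B| < s)%N.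
Proof.
move=> /forallP/(_ A)/forallP/(_ B)/implyP link dAB nadj.
case: (ltnP #|A| s) => [|sA]; first by left.
case: (ltnP #|B| s) => [|sB]; first by right.
have /negP[] := link ltac:(by rewrite dAB sA sB).
by apply/forall_inP => x xA; apply/forall_inP => y yB; exact: nadj.
Qed.

(* The vertices outside the bag of [t] all of whose bags lie beyond the edge
   from [t] to its neighbour [a]; one bag there is enough. *)
Definition branch (V T : finType) (F : sgraph T) (B : T -> {set V}) (t a : T)
    : {set V} :=
  [set v | (v \notin B t) &&
    [exists u, (v \in B u) && connect (adj_avoid F t) a u]]%SET.

Section TreeDecomposition.
Variables (V T : finType) (G : sgraph V) (F : sgraph T) (B : T -> {set V}).
Hypothesis dec : is_tree_decomposition G F B.

Lemma bag_of_adj (v w : V) : adj G v w -> exists u, (v \in B u) && (w \in B u).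
Proof.
case: dec => _ _ edges _ /existsP[e /andP[eG /eqP evw]].
have [u eBu] := edges e eG; exists u; rewrite evw in eBu.
by rewrite !(fintype.subsetP eBu)// !inE eqxx ?orbT.
Qed.

Lemma bags_connect_avoid (t : T) (v : V) (u u' : T) : v \notin B t ->
  v \in B u -> v \in B u' -> connect (adj_avoid F t) u u'.
Proof.
case: dec => _ _ _ conn vt vu vu'.
apply: connect_sub (conn v u u' vu vu') => a b /and3P[Fab va vb].
apply: connect1; rewrite /adj_avoid Fab /=.
by apply/andP; split; apply: contraNneq vt => <-.
Qed.

Lemma branch_connect (t a : T) (v : V) (u : T) :
  v \in branch F B t a -> v \in B u -> connect (adj_avoid F t) a u.
Proof.
rewrite !inE => /andP[vt /existsP[u' /andP[vu' cau']]] vu.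
exact: connect_trans cau' (bags_connect_avoid vt vu' vu).
Qed.

(** Label each vertex outside the bag of [t] by the component of the tree minus [t] that holds its
    bags. Adjacent vertices share a bag, hence a label, so any splitting of the labels separates two
    vertex sets with no edge between; one of them is small and [exists_large_class] applies. *)
Lemma exists_large_branch (s : nat) (t : T) :
  large_sets_linked G s -> (0 < s)%N -> (3 * s <= #|~: B t|)%N ->
  exists2 a, adj F t a & (s <= #|branch F B t a|)%N.
Proof.
move=> link s0 sU; case: (dec) => -[_ connF _] cover _ _.
pose bag v := xchoose (cover v).
have bagP v : v \in B (bag v) by exact: (xchooseP (cover v)).
pose g v := fingraph.root (adj_avoid F t) (bag v).
have rootE u u' : connect (adj_avoid F t) u u' =
    (fingraph.root (adj_avoid F t) u == fingraph.root (adj_avoid F t) u').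
  by rewrite root_connect//; exact: adj_avoid_csym.
have g_adj v w : v \notin B t -> w \notin B t -> adj G v w -> g v = g w.
  move=> vt wt /bag_of_adj[u /andP[vu wu]]; apply/eqP; rewrite -rootE.
  apply: (@connect_trans _ _ u); first exact: bags_connect_avoid vt _ vu.
  exact: bags_connect_avoid wt wu _.
have [|c sc] := exists_large_class (g := g) s0 sU.
  move=> D; apply: (large_sets_linkedP link).
    by apply/fintype.pred0P => v; rewrite /= !inE; case: (g v \in D); rewrite ?andbF.
  move=> v w; rewrite !inE => /andP[vt vD] /andP[wt wD].
  by apply: contraNN wD => /(g_adj _ _ vt wt) <-.
have [v] : exists v, v \in [set v in ~: B t | g v == c]%SET.
  by apply/card_gt0P; exact: leq_trans s0 sc.
rewrite !inE => /andP[vt /eqP gv].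
(* The component with label [c] is entered from [t] through a neighbour [a]. *)
have vbt : bag v != t by apply: contraNneq vt => <-.
have [a Fta cav] := connect_first_step vbt (connF t (bag v)).
exists a => //; apply: leq_trans sc _; apply/subset_leq_card/fintype.subsetP => w.
rewrite !inE => /andP[-> /eqP gw]; apply/existsP; exists (bag w); rewrite bagP/=.
by apply: connect_trans cav _; rewrite rootE; apply/eqP; rewrite -/(g v) gv -gw.
Qed.

Lemma max_bag_of_linked (s : nat) : large_sets_linked G s -> (0 < s)%N ->
  (#|V| < max_bag B + 3 * s)%N.
Proof.
move=> link s0; rewrite ltnNge; apply/negP => small.
case: (dec) => -[/card_gt0P[t0 _] _ acyc] _ _ _.
have sU t : (3 * s <= #|~: B t|)%N.
  have := leq_bigmax (F := fun t => #|B t|) t; rewrite -/(max_bag B).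
  by have := cardsC (B t); lia.
have ex t : exists a, adj F t a && (s <= #|branch F B t a|)%N.
  by have [a Fa sa] := exists_large_branch link s0 (sU t); exists a; rewrite Fa.
pose f t := xchoose (ex t).
have fP t : adj F t (f t) && (s <= #|branch F B t (f t)|)%N by exact: (xchooseP (ex t)).
have [t fft] := acyclic_pointer_2cycle t0 acyc (fun t => proj1 (andP (fP t))).
have /andP[Fta sA] := fP t; have /andP[_ sB] := fP (f t); rewrite fft in sB.
have [] : (#|branch F B t (f t)| < s)%N \/ (#|branch F B (f t) t| < s)%N; last 2 first.
- by rewrite ltnNge sA.
- by rewrite ltnNge sB.
(* A bag containing both [v] and [w] would lie beyond both ends of the edge. This gives disjointness
   when [w] is [v], and otherwise the absence of edges. *)
have sep v w u : v \in branch F B t (f t) -> w \in branch F B (f t) t ->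
    v \in B u -> w \in B u -> False.
  move=> vA wB vu wu; apply: (acyclic_edge_separates acyc Fta (u := u)).
    exact: branch_connect vA vu.
  exact: branch_connect wB wu.
apply: (large_sets_linkedP link).
  apply/fintype.pred0P => v /=; apply/negP => /andP[vA vB].
  by case: (dec) => _ /(_ v)[u vu] _ _; exact: (sep v v u).
move=> v w vA wB; apply/negP => /bag_of_adj[u /andP[vu wu]].
exact: (sep v w u).
Qed.

End TreeDecomposition.

(** * Deterministic bounds on the tree-width *)

Lemma treewidth_le_card (V : finType) (G : sgraph V) : treewidth G <= #|V|%:Z - 1.
Proof.
rewrite /treewidth lerD2r lez_nat.
case: ex_minnP => k /asboolP[T [F [B [_ <-]]]] _.
by apply/bigmax_leqP => t _; exact: max_card.
Qed.

Lemma treewidth_ge_linked (V : finType) (G : sgraph V) (s : nat) :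
  large_sets_linked G s -> (0 < s)%N -> #|V|%:Z - (3 * s)%:Z <= treewidth G.
Proof.
move=> link s0; rewrite /treewidth.
case: ex_minnP => k /asboolP[T [F [B [dec <-]]]] _.
(* The strict inequality pays for the [- 1] in [treewidth]. *)
by have := max_bag_of_linked dec link s0; lia.
Qed.

(** * Probability estimates in the random graph *)

Section Gnp.
Variables (R : realType) (n : nat) (p : R).
Hypothesis p01 : 0 <= p <= 1.

Lemma Gnp_weight_ge0 (G : sgraph 'I_n) : 0 <= Gnp_weight p G.
Proof.
by case/andP: p01 => p0 p1; apply: prodr_ge0 => e _; case: ifP; rewrite ?subr_ge0.
Qed.

(** Giving the pairs of [E] weight 0 when present turns the event into a product weight. The sum
    over graphs then factors, with factor [1 - p] on [E] and [p + (1 - p) = 1] elsewhere. *)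
Lemma Gnp_prob_avoid (E : {set vpair 'I_n}) :
  Gnp_prob p (fun G => [disjoint G & E]) = (1 - p) ^+ #|E|.
Proof.
pose q (e : vpair 'I_n) := if e \in E then 0 else p.
transitivity (\sum_(G : sgraph 'I_n) \prod_(e : vpair 'I_n)
    (if e \in G then q e else 1 - p)).
  rewrite /Gnp_prob big_mkcond; apply: eq_bigr => G _.
  case: ifPn => [dGE|/pred0Pn[e /andP[/= eG eE]]].
    apply: eq_bigr => e _; case: ifP => // eG.
    by rewrite /q (disjointFr dGE eG).
  by rewrite (bigD1 e)//= eG /q eE mul0r.
rewrite -bigA_distr -prodr_const [RHS]big_mkcond; apply: eq_bigr => e _ /=.
by rewrite /q; case: ifP => _; rewrite ?add0r// addrC subrK.
Qed.

Lemma Gnp_probT : Gnp_prob p (fun _ : sgraph 'I_n => true) = 1.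
Proof.
transitivity ((1 - p) ^+ #|@finset.set0 (vpair 'I_n)|); last by rewrite cards0.
rewrite -Gnp_prob_avoid.
by apply: eq_bigl => G; apply/esym/fintype.pred0P => e; rewrite /= inE andbF.
Qed.

Lemma Gnp_prob_le1 (A : pred (sgraph 'I_n)) : Gnp_prob p A <= 1.
Proof.
rewrite -Gnp_probT /Gnp_prob [leRHS](bigID A)/= lerDl.
by apply: sumr_ge0 => G _; exact: Gnp_weight_ge0.
Qed.

Lemma Gnp_probC (A : pred (sgraph 'I_n)) :
  Gnp_prob p A = 1 - Gnp_prob p (fun G => ~~ A G).
Proof. by rewrite -Gnp_probT /Gnp_prob [X in X - _](bigID A)/= addrK. Qed.

Lemma Gnp_prob_mono (A A' : pred (sgraph 'I_n)) :
  (forall G, A G -> A' G) -> Gnp_prob p A <= Gnp_prob p A'.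
Proof.
move=> sAA'; rewrite /Gnp_prob [leRHS](bigID A)/=.
rewrite [X in _ <= X + _](eq_bigl A) => [|G]; last by apply/andb_idl; exact: sAA'.
by rewrite lerDl; apply: sumr_ge0 => G _; exact: Gnp_weight_ge0.
Qed.

Lemma Gnp_prob_union (I : finType) (A : I -> pred (sgraph 'I_n)) :
  Gnp_prob p (fun G => [exists i, A i G]) <= \sum_i Gnp_prob p (A i).
Proof.
rewrite /Gnp_prob; under [leRHS]eq_bigr do rewrite big_mkcond.
rewrite exchange_big big_mkcond /=; apply: ler_sum => G _.
have w0 i : 0 <= (if A i G then Gnp_weight p G else 0).
  by case: ifP => // _; exact: Gnp_weight_ge0.
case: ifPn => [/existsP[i Ai]|_]; last exact: sumr_ge0.
by rewrite (bigD1 i)//= Ai lerDl; exact: sumr_ge0.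
Qed.

Definition crossing_pairs (A B : {set 'I_n}) : {set vpair 'I_n} :=
  [set e | [exists x in A, exists y in B, val e == [set x; y]%SET]]%SET.

Lemma card_crossing_pairs (A B : {set 'I_n}) :
  [disjoint A & B] -> (#|A| * #|B| <= #|crossing_pairs A B|)%N.
Proof.
move=> dAB; rewrite -cardsX.
pose f (u : 'I_n * 'I_n) := [set u.1; u.2]%SET.
(* As [A] and [B] are disjoint, a crossing pair determines which of its ends lies in [A]. *)
have f_inj : {in finset.setX A B &, injective f}.
  move=> [a b] [c d] /finset.setXP[/= aA bB] /finset.setXP[/= cA dB] /finset.setP fE.
  have := fE a; have := fE b; rewrite !inE !eqxx orbT /=.
  have neq x y : x \in A -> y \in B -> (y == x) = false.
    by move=> xA yB; apply: contraTF yB => /eqP ->; rewrite (disjointFr dAB).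
  rewrite (neq c b)// [a == d]eq_sym (neq a d)// orbF /=.
  by move=> /esym/eqP -> /esym/eqP ->.
rewrite -(card_in_imset f_inj) -[leqRHS](card_imset _ val_inj).
apply/subset_leq_card/fintype.subsetP => _ /imsetP[[a b] /finset.setXP[/= aA bB] ->].
have ab : #|f (a, b)| == 2%N.
  by rewrite cards2 (contraTneq _ bB)// => /= <-; rewrite (disjointFr dAB).
apply/imsetP; exists (Sub (f (a, b)) ab : vpair 'I_n) => //.
by rewrite inE; apply/exists_inP; exists a => //; apply/exists_inP; exists b.
Qed.

Lemma no_edge_between_avoid (G : sgraph 'I_n) (A B : {set 'I_n}) :
  no_edge_between G A B -> [disjoint G & crossing_pairs A B].
Proof.
move=> nadj; apply/fintype.pred0P => e /=; apply/negP => /andP[eG].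
rewrite inE => /exists_inP[x xA /exists_inP[y yB exy]].
have /forall_inP/(_ y yB)/negP[] := forall_inP nadj x xA.
by apply/existsP; exists e; rewrite eG.
Qed.

Lemma Gnp_prob_not_linked (s : nat) :
  Gnp_prob p (fun G : sgraph 'I_n => ~~ large_sets_linked G s)
    <= 4 ^+ n * (1 - p) ^+ (s * s).
Proof.
have /andP[p0 p1] := p01.
pose bad (AB : {set 'I_n} * {set 'I_n}) (G : sgraph 'I_n) :=
  [&& [disjoint AB.1 & AB.2], s <= #|AB.1|, s <= #|AB.2|
    & no_edge_between G AB.1 AB.2]%N.
apply: (@le_trans _ _ (Gnp_prob p (fun G => [exists AB, bad AB G]))).
  apply: Gnp_prob_mono => G /forallPn[A /forallPn[B]].
  rewrite negb_imply negbK => /andP[/and3P[dAB sA sB] nadj].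
  by apply/existsP; exists (A, B); rewrite /bad /= dAB sA sB.
apply: le_trans (Gnp_prob_union _) _.
have -> : 4 ^+ n = #|{: {set 'I_n} * {set 'I_n}}|%:R :> R.
  rewrite card_prod -!cardsT -powersetT card_powerset cardsT card_ord.
  by rewrite -expnMn natrX.
rewrite mulr_natl -sumr_const; apply: ler_sum => -[A B] _.
(* Pairs of sets that overlap or are too small contribute probability 0. *)
have [/and3P[dAB sA sB]|nbad] :=
    boolP [&& [disjoint A & B], s <= #|A| & s <= #|B|]%N; last first.
  rewrite /Gnp_prob big_pred0 ?exprn_ge0 ?subr_ge0// => G.
  by apply: contraNF nbad => /and4P[/= -> -> ->].
apply: (@le_trans _ _ (Gnp_prob p (fun G => [disjoint G & crossing_pairs A B]))).
  by apply: Gnp_prob_mono => G /and4P[_ _ _]; exact: no_edge_between_avoid.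
rewrite Gnp_prob_avoid ler_wiXn2l ?subr_ge0 ?gerBl//.
exact: leq_trans (leq_mul sA sB) (card_crossing_pairs dAB).
Qed.

End Gnp.

(** * Choice of constants and the limit *)

Lemma four_expRN4_lt1 (R : realType) : 4 * expR (- 4) < 1 :> R.
Proof.
rewrite expRN -[_ < 1]/(4 / expR 4 < 1) ltr_pdivrMr ?expR_gt0// mul1r.
by apply: lt_le_trans (expR_ge1Dx 4); lra.
Qed.

Lemma Gnp_prob_not_linked_sqrt (R : realType) (n : nat) (p : R) (s : nat) :
  0 < p <= 1 -> 2 * Num.sqrt (n%:R / p) <= s%:R ->
  Gnp_prob p (fun G : sgraph 'I_n => ~~ large_sets_linked G s)
    <= (4 * expR (- 4)) ^+ n.
Proof.
move=> /andP[p0 p1] sn.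
have p01 : 0 <= p <= 1 by rewrite ltW.
apply: (le_trans (Gnp_prob_not_linked n p01 s)).
rewrite exprMn ler_pM2l ?exprn_gt0// -expRM_natl.
apply: (@le_trans _ _ (expR (- p) ^+ (s * s))).
  by rewrite lerXn2r ?nnegrE ?subr_ge0 ?expR_ge0//; exact: expR_ge1Dx.
rewrite -expRM_natl ler_expR !mulrN lerN2 natrM.
have np0 : 0 <= n%:R / p by rewrite divr_ge0// ltW.
(* Squaring and multiplying by [p] gives [4 n <= p s^2]. *)
have : (2 * Num.sqrt (n%:R / p)) ^+ 2 <= s%:R ^+ 2.
  by rewrite lerXn2r ?nnegrE ?mulr_ge0 ?sqrtr_ge0.
rewrite exprMn sqr_sqrtr// => sq; rewrite -(ler_pM2r p0) in sq.
have npE : n%:R / p * p = n%:R by rewrite divfK ?gt_eqF.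
lra.
Qed.

(** With [x = sqrt (n/p) >= 1], the threshold is at most [2 x + 1 <= 3 x]; the loss of three
    thresholds is thus at most [9 x]. *)
Lemma treewidth_bounds_of_linked (R : realType) (n : nat) (p : R) (G : sgraph 'I_n) :
  (0 < n)%N -> 0 < p <= 1 ->
  large_sets_linked G (Num.truncn (2 * Num.sqrt (n%:R / p))).+1 ->
  n%:R - 9 * Num.sqrt (n%:R / p) <= ((treewidth G)%:~R : R) <= n%:R.
Proof.
move=> n0 /andP[p0 p1] link; set x := Num.sqrt _ in link *.
have x1 : 1 <= x.
  have np1 : 1 <= n%:R / p by rewrite ler_pdivlMr// mul1r (le_trans p1)// ler1n.
  by rewrite -[leLHS]sqrtr1 ler_sqrt// (le_trans ler01).
have tx : (Num.truncn (2 * x))%:R <= 2 * x by rewrite truncn_le mulr_ge0 ?sqrtr_ge0.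
have := treewidth_ge_linked link isT; have := treewidth_le_card G.
rewrite card_ord; move: (treewidth G) (Num.truncn _) tx => t k tx.
rewrite -!(ler_int R) !intrB => up lo.
clearbody x; apply/andP; split; lra.
Qed.

Local Open Scope classical_set_scope.

Theorem mainTheorem3 (R : realType) (p : nat -> R)
    (p01 : forall n : nat, 0 <= p n <= 1)
    (np_oo : n%:R * p n @[n --> \oo] --> +oo) :
  exists C : R, 0 < C /\
    Gnp_prob (p n) (fun G : sgraph 'I_n =>
      n%:R - C * Num.sqrt (n%:R / p n) <= ((treewidth G)%:~R : R) <= n%:R)
      @[n --> \oo] --> (1 : R).
Proof.
exists 9; split=> //.
apply: (@squeeze_cvgr _ _ _ _ (fun n => 1 - (4 * expR (- 4)) ^+ n) (fun=> 1)).
(* Eventually [n * p n > 0], so [n] and [p n] are positive and [n / p n] is a genuine quotient. *)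
- have /cvgryPgt/(_ 0) := np_oo; apply: filterS => n np0.
  rewrite Gnp_prob_le1// andbT Gnp_probC// lerB//.
  have n0 : (0 < n)%N by case: n np0 => //; rewrite mul0r ltxx.
  have pn : 0 < p n <= 1.
    by have /andP[_ ->] := p01 n; move: np0; rewrite pmulr_rgt0 ?ltr0n// => ->.
  apply: (le_trans _ (Gnp_prob_not_linked_sqrt pn (ltW (truncnS_gt _)))).
  apply: Gnp_prob_mono => // G; apply: contraNN.
  exact: treewidth_bounds_of_linked.
- rewrite -[X in _ --> X]subr0; apply: cvgB; first exact: cvg_cst.
  apply: cvg_expr; rewrite ger0_norm ?mulr_ge0 ?expR_ge0//.
  exact: four_expRN4_lt1.
- exact: cvg_cst.
Qed.
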